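(* Let $G$ be a finite simple graph. Then $$\lambda(\mathcal{D}[G])=\begin{cases}2\lambda(G), & \text{if } \lambda(G)=\delta(G),\\ 4\lambda(G), & \text{if } \lambda(G)\le\frac{\delta(G)}{2},\\ 2\delta(G), & \text{if } \frac{\delta(G)}{2}<\lambda(G)<\delta(G),\end{cases}$$ where $\lambda$ denotes edge-connectivity and $\delta$ minimum degree.
   Context: The total graph $T_2$ is $K_2$ with a loop added at each of its two vertices. The double graph is $\mathcal{D}[G]=G\times T_2$ (Kronecker product): it has vertex set $V(G)\times\{0,1\}$ and $(u,i)$ is adjacent to $(v,j)$ iff $uv\in E(G)$. *)

(* Defs.v *)
From mathcomp Require Import all_boot.

Set Implicit Arguments.
Unset Strict Implicit.
Unset Printing Implicit Defensive.

(* A graph on V is an adjacency relation e : rel V, assumed symmetric where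
   it matters; a simple graph is a symmetric irreflexive one. *)

Definition kronecker (V W : finType) (e : rel V) (f : rel W) :
    rel (V * W)%type :=
  [rel x y | e x.1 y.1 && f x.2 y.2].

(* K_n with a loop at each vertex: every ordered pair is adjacent. *)
Definition total_graph (n : nat) : rel 'I_n := [rel i j | true].

Definition double_graph (V : finType) (e : rel V) : rel (V * 'I_2)%type :=
  kronecker e (@total_graph 2).

Section Invariants.

Variables (V : finType) (e : rel V).

Definition degree (v : V) : nat := #|[set w | e v w]|.

(* Every degree is at most #|V|, so the default value of the minimum only
   matters on the empty vertex set, where it gives 0. *)
Definition min_degree : nat := \big[minn/#|V|]_(v : V) degree v.

Definition edges : {set {set V}} :=
  [set [set p.1; p.2] | p : V * V & e p.1 p.2].

Definition delete_edges (F : {set {set V}}) : rel V :=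
  [rel u v | e u v && ([set u; v] \notin F)].

Definition connected_graph (f : rel V) : bool :=
  [forall u, forall v, connect f u v].

(* The second disjunct gives graphs with at most one vertex
   edge-connectivity 0. *)
Definition disconnecting (F : {set {set V}}) : bool :=
  (F \subset edges) &&
  (~~ connected_graph (delete_edges F) || (#|V| <= 1)).

(* The set of all edges is always disconnecting, so this is a genuine
   minimum. *)
Definition edge_connectivity : nat :=
  #|[arg min_(F < edges | disconnecting F) #|F|]|.

End Invariants.

(* Main.v *)
Require Import Defs.
From mathcomp Require Import all_boot.

(* Edge-connectivity is the minimum size of the boundary of a nonempty proper
   vertex set X. In the double graph, if X meets some fibre {u} x {0,1} in
   exactly one vertex, then each of the 2 deg(u) vertices adjacent to that
   fibre yields its own boundary edge of X. Otherwise X = S x {0,1}, and its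
   boundary is four times that of S. Hence lambda(D[G]) is the minimum of
   4 lambda(G) and 2 delta(G). *)

(* Boundary edges are oriented from S to its complement, so that they are
   counted once without quotienting pairs by symmetry. *)
Definition boundary {V : finType} (e : rel V) (S : {set V}) : {set V * V} :=
  [set p | [&& e p.1 p.2, p.1 \in S & p.2 \notin S]].

Section EdgeConnectivity.

Variables (V : finType) (e : rel V).

Lemma connect_closed_set (f : rel V) (S : {set V}) (x y : V) :
  (forall a b, f a b -> a \in S -> b \in S) ->
  connect f x y -> x \in S -> y \in S.
Proof.
move=> clS /connectP[p]; elim: p x => [|z p IHp] x /=; first by move=> _ ->.
by move=> /andP[fxz fp] lastp xS; apply: IHp fp lastp (clS _ _ fxz xS).
Qed.

(** The witness that [arg_minnP] requires: once every edge is deleted, any singleton is closed under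
    adjacency. *)
Lemma disconnecting_edges : disconnecting e (edges e).
Proof.
rewrite /disconnecting subxx /=.
case: (leqP #|V| 1) => [_|V_gt1]; first by rewrite orbT.
have /card_gt1P[x [y [_ _ neq_xy]]] := V_gt1.
rewrite orbF; apply/negP => /forallP/(_ x)/forallP/(_ y) con_xy.
have clx a b : delete_edges e (edges e) a b -> a \in [set x] -> b \in [set x].
  case/andP=> eab /negP[]; apply/imsetP.
  by exists (a, b); rewrite ?inE.
have := connect_closed_set _ _ _ _ clx con_xy (set11 x).
by rewrite inE eq_sym (negPf neq_xy).
Qed.

Lemma edge_connectivity_le (F : {set {set V}}) :
  disconnecting e F -> edge_connectivity e <= #|F|.
Proof.
rewrite /edge_connectivity.
by case: arg_minnP => [|F0 _ F0min]; [exact: disconnecting_edges | exact: F0min].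
Qed.

Lemma edge_connectivity_attained :
  exists2 F, disconnecting e F & edge_connectivity e = #|F|.
Proof.
rewrite /edge_connectivity; case: arg_minnP => [|F F_disc _].
  exact: disconnecting_edges.
by exists F.
Qed.

Lemma edge_connectivity_small : #|V| <= 1 -> edge_connectivity e = 0.
Proof.
move=> V_le1; apply/eqP; rewrite -leqn0 -(cards0 {set V}).
by apply: edge_connectivity_le; rewrite /disconnecting sub0set V_le1 orbT.
Qed.

(** Forgetting orientations turns the boundary into a set of edges whose deletion leaves no step out
    of [S], so [x] no longer reaches [y]. *)
Lemma edge_connectivity_le_boundary (S : {set V}) (x y : V) :
  x \in S -> y \notin S -> edge_connectivity e <= #|boundary e S|.
Proof.
move=> xS yS.
apply: leq_trans (leq_imset_card (fun p => [set p.1; p.2]) _).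
apply/edge_connectivity_le/andP; split.
  apply/subsetP=> A /imsetP[p]; rewrite inE => /and3P[ep _ _] ->.
  by apply/imsetP; exists p; rewrite ?inE.
apply/orP; left; apply/negP => /forallP/(_ x)/forallP/(_ y) con_xy.
case/negP: yS; apply: connect_closed_set con_xy xS => a b /andP[eab abF] aS.
apply: contraR abF => bS; apply/imsetP; exists (a, b) => //.
by rewrite inE /= eab aS.
Qed.

(** The orientation can be recovered from the unordered pair, since exactly one endpoint lies in
    [S]. *)
Lemma boundary_endpoints_inj (S : {set V}) :
  {in boundary e S &, injective (fun p : V * V => [set p.1; p.2])}.
Proof.
move=> [a b] [c d]; rewrite !inE /= => /and3P[_ aS bS] /and3P[_ cS dS] eq_abcd.
have /set2P[ac | ad] : a \in [set c; d] by rewrite -eq_abcd set21.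
  have /set2P[bc | bd] : b \in [set c; d] by rewrite -eq_abcd set22.
    by rewrite bc cS in bS.
  by rewrite ac bd.
by rewrite -ad aS in dS.
Qed.

Lemma edge_connectivity_boundary :
  1 < #|V| -> exists S : {set V}, exists x : V, exists y : V,
    [/\ x \in S, y \notin S & edge_connectivity e = #|boundary e S|].
Proof.
move=> V_gt1; have [F F_disc lambdaF] := edge_connectivity_attained.
have /andP[_] := F_disc; rewrite leqNgt V_gt1 orbF.
case/forallPn => x /forallPn[y ncon_xy].
(* Every edge leaving the set reachable from [x] must lie in [F], as otherwise its far end would be
   reachable too. *)
pose S := [set z | connect (delete_edges e F) x z].
have xS : x \in S by rewrite inE.
have yS : y \notin S by rewrite inE.
exists S, x, y; split=> //; apply/eqP; rewrite eqn_leq.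
rewrite (edge_connectivity_le_boundary _ _ _ xS yS) lambdaF /=.
rewrite -(card_in_imset (boundary_endpoints_inj S)); apply/subset_leq_card.
apply/subsetP=> A /imsetP[[a b]]; rewrite !inE /= => /and3P[eab aS bS] ->.
apply: contraR bS => abF; apply: connect_trans aS (connect1 _).
  exact/andP.
Qed.

(** The singleton of [v] is a cut as soon as there is a second vertex, and its boundary has at most
    [degree e v] elements. *)
Lemma edge_connectivity_le_degree (v : V) : edge_connectivity e <= degree e v.
Proof.
case: (leqP #|V| 1) => [/edge_connectivity_small-> // | V_gt1].
have [w neq_wv] : exists w, w != v.
  have /card_gt1P[x [y [_ _ neq_xy]]] := V_gt1.
  by case: (eqVneq x v) neq_xy => [-> | ? _]; [exists y; rewrite eq_sym | exists x].
have wNv : w \notin [set v] by rewrite inE.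
apply: leq_trans (edge_connectivity_le_boundary _ _ _ (set11 v) wNv) _.
apply: leq_trans (leq_imset_card (pair v) [set u | e v u]).
apply/subset_leq_card/subsetP=> -[a b].
rewrite !inE /= => /and3P[eab /eqP av _].
by apply/imsetP; exists b; rewrite ?inE -av.
Qed.

Lemma min_degree_le (v : V) : min_degree e <= degree e v.
Proof.
rewrite /min_degree; have := mem_index_enum v.
elim: index_enum => // w r IHr; rewrite inE big_cons geq_min.
by case/predU1P=> [-> | /IHr->]; rewrite ?leqnn ?orbT.
Qed.

Lemma min_degree_attained (v0 : V) : exists v, min_degree e = degree e v.
Proof.
have [v _ vmin] := arg_minnP (degree e) (isT : predT v0).
exists v; apply/eqP; rewrite eqn_leq min_degree_le /=.
rewrite /min_degree; elim/big_ind: _ => [|m n lem len|w _].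
(* The default value [#|V|] of the iterated minimum is also at least [degree e v]. *)
- exact: max_card.
- by rewrite leq_min lem.
- exact: vmin.
Qed.

End EdgeConnectivity.

Section DoubleGraph.

Variables (V : finType) (e : rel V).

Lemma double_graphE (x y : V * 'I_2) : double_graph e x y = e x.1 y.1.
Proof. exact: andbT. Qed.

Lemma degree_double (v : V) (i : 'I_2) :
  degree (double_graph e) (v, i) = 2 * degree e v.
Proof.
have -> : 2 * degree e v = #|setX [set w | e v w] [set: 'I_2]|.
  by rewrite cardsX cardsT card_ord mulnC.
by apply: eq_card => -[w k]; rewrite !inE double_graphE andbT.
Qed.

(** Each boundary edge of [S] lifts to four edges, one for each choice of layers at its two ends;
    [f] only regroups coordinates. *)
Lemma boundary_double_fibres (S : {set V}) :
  #|boundary (double_graph e) (setX S [set: 'I_2])| = 4 * #|boundary e S|.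
Proof.
pose f (q : (V * V) * ('I_2 * 'I_2)) := ((q.1.1, q.2.1), (q.1.2, q.2.2)).
have f_inj : injective f by move=> [[a b] [i j]] [[c d] [k l]] [-> -> -> ->].
have -> : 4 * #|boundary e S| = #|setX (boundary e S) [set: 'I_2 * 'I_2]|.
  by rewrite cardsX cardsT card_prod card_ord mulnC.
rewrite -(card_imset _ f_inj); apply: eq_card => -[[a i] [b j]].
rewrite !inE double_graphE /= !andbT; apply/idP/imsetP => [bd_ab | [[[c d] [k l]]]].
  by exists ((a, b), (i, j)); rewrite // !inE /= andbT.
by rewrite !inE /= andbT => bd_cd [-> _ -> _].
Qed.

Lemma boundary_double_split (X : {set V * 'I_2}) (u : V) (i j : 'I_2) :
  symmetric e -> irreflexive e -> (u, i) \in X -> (u, j) \notin X ->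
  2 * degree e u <= #|boundary (double_graph e) X|.
Proof.
move=> e_sym e_irr uiX ujX; rewrite -(degree_double u i).
(* Adjacency ignores layers, so a neighbour of [(u, i)] is also one of [(u, j)]. Whichever side of
   the cut [y] is on, one of these two vertices is on the other. *)
pose f y := if y \in X then (y, (u, j)) else ((u, i), y).
have f_inj : {in [set y | double_graph e (u, i) y] &, injective f}.
  move=> [a k] [b l]; rewrite !inE !double_graphE /f /= => ea eb.
  case: ifP => _; case: ifP => _; case=> //.
  - by move=> -> ->.
  (* In the two mixed cases a collision would make [u] adjacent to itself. *)
  - by move=> au; rewrite au e_irr in ea.
  - by move=> ub; rewrite -ub e_irr in eb.
  - by move=> -> ->.
rewrite /degree -(card_in_imset f_inj); apply/subset_leq_card/subsetP=> p.
case/imsetP=> -[a k]; rewrite inE double_graphE /f /= => ea ->.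
by case: ifP => akX; rewrite inE double_graphE /= ?(e_sym a) ea ?akX ?uiX.
Qed.

Lemma edge_connectivity_double :
  symmetric e -> irreflexive e ->
  edge_connectivity (double_graph e) =
    minn (4 * edge_connectivity e) (2 * min_degree e).
Proof.
move=> e_sym e_irr.
have [v0 _ | V0] := pickP V; last first.
  have cardV : #|V| = 0 by apply: eq_card0.
  by rewrite !edge_connectivity_small ?card_prod ?cardV // min0n.
have [v deg_v] := min_degree_attained _ e v0.
have le_2delta : edge_connectivity (double_graph e) <= 2 * min_degree e.
  by rewrite deg_v -(degree_double v ord0) edge_connectivity_le_degree.
apply/eqP; rewrite eqn_leq leq_min le_2delta andbT geq_min.
case: (leqP #|V| 1) => [V_le1 | V_gt1].
  (* The double of a one-vertex graph has two vertices, so the convention for small graphs does not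
     cover it; looplessness bounds it through the minimum degree instead. *)
  have delta0 : min_degree e = 0.
    rewrite deg_v; apply: eq_card0 => w; rewrite inE.
    by have /card_le1_eqP/(_ v w isT isT)-> := V_le1; rewrite e_irr.
  rewrite (leq_trans le_2delta) ?delta0 //=.
  by rewrite edge_connectivity_small.
apply/andP; split.
  (* Upper bound: lift a minimum cut of the base graph to whole fibres. *)
  have [S [x [y [xS yS ->]]]] := edge_connectivity_boundary _ e V_gt1.
  rewrite -boundary_double_fibres.
  apply: (@edge_connectivity_le_boundary _ _ _ (x, ord0) (y, ord0)).
    by rewrite !inE xS.
  by rewrite !inE (negPf yS).
(* Lower bound: take a minimum cut [X] of the double and ask whether it splits a fibre. *)
have V2_gt1 : 1 < #|{: V * 'I_2}|.
  by rewrite card_prod card_ord (leq_trans V_gt1) ?leq_pmulr.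
have [X [[a k] [[b l] [aX bX ->]]]] :=
  edge_connectivity_boundary _ (double_graph e) V2_gt1.
have [/existsP[u /existsP[i /existsP[j /andP[uiX ujX]]]] | no_split] :=
  boolP [exists u, exists i, exists j, ((u, i) \in X) && ((u, j) \notin X)].
  apply/orP; right.
  apply: leq_trans (boundary_double_split X u i j e_sym e_irr uiX ujX).
  by rewrite leq_mul2l min_degree_le.
have fibre u i j : (u, i) \in X -> (u, j) \in X.
  move=> uiX; apply: contraR no_split => ujX.
  by apply/existsP; exists u; apply/existsP; exists i; apply/existsP; exists j;
    rewrite uiX.
pose S := [set u | (u, ord0) \in X].
have XE : X = setX S [set: 'I_2].
  by apply/setP=> -[u i]; rewrite !inE andbT; apply/idP/idP; apply: fibre.
apply/orP; left; rewrite XE boundary_double_fibres leq_mul2l /=.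
apply: (@edge_connectivity_le_boundary _ _ _ a b).
  by rewrite inE (fibre _ _ _ aX).
by rewrite inE; apply: contra bX; apply: fibre.
Qed.

End DoubleGraph.

Theorem theorem3p4 (V : finType) (e : rel V)
    (e_sym : symmetric e) (e_irr : irreflexive e) :
  [/\ edge_connectivity e = min_degree e ->
        edge_connectivity (double_graph e) = 2 * edge_connectivity e,
      2 * edge_connectivity e <= min_degree e ->
        edge_connectivity (double_graph e) = 4 * edge_connectivity e
    & min_degree e < 2 * edge_connectivity e ->
      edge_connectivity e < min_degree e ->
        edge_connectivity (double_graph e) = 2 * min_degree e].
Proof.
rewrite (edge_connectivity_double _ _ e_sym e_irr).
(* Factoring out 2 leaves the minimum of [2 * edge_connectivity e] and [min_degree e], which is the
   comparison made by the three cases. *)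
rewrite -[4]/(2 * 2) -mulnA -minnMr; split=> [-> | /minn_idPl-> // | lt_d _].
  by rewrite (minn_idPr (leq_pmull _ _)).
by rewrite (minn_idPr (ltnW lt_d)).
Qed.
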